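(* Let $A$ be a commutative ring with unity, let $n\geq 1$, and let $f(t)=t^n-f_1t^{n-1}+f_2t^{n-2}-\cdots+(-1)^nf_n$ be a polynomial whose coefficients $f_1,\dots,f_n$ are algebraically independent over $A$. Let $A[f_1,\dots,f_n]_f$ be the splitting algebra of $f$ over $A[f_1,\dots,f_n]$, with universal roots $\tau_1,\dots,\tau_n$. Then: (1) The ring of invariants of $A[f_1,\dots,f_n]_f$ under the action of $\mathfrak S_n$ is $A[f_1,\dots,f_n]$. (2) The universal roots $\tau_1,\dots,\tau_n$ of $f(t)$ in $A[f_1,\dots,f_n]_f$ are algebraically independent over $A$. (3) The ring $A[f_1,\dots,f_n]_f$ is free as an $A[f_1,\dots,f_n]$-module, with a basis given by the monomials $\tau_2^{m_2}\tau_3^{m_3}\cdots\tau_n^{m_n}$ with $0\leq m_i<i$ for $i=2,3,\dots,n$.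
   Context: Rings are commutative with unity. Elements $f_1,\dots,f_n$ of an $A$-algebra are algebraically independent over $A$ if they are not roots of any non-zero polynomial in $n$ variables with coefficients in $A$; then $A[f_1,\dots,f_n]$ is a polynomial ring over $A$. Splitting algebra: for a ring $B$ and a monic polynomial $f(t)=t^n-f_1t^{n-1}+\cdots+(-1)^nf_n$ in $B[t]$, $B_f$ is the quotient of the polynomial ring $B[t_1,\dots,t_n]$ by the ideal generated by $s_1-f_1,\dots,s_n-f_n$, where $s_1,\dots,s_n$ are the elementary symmetric functions of $t_1,\dots,t_n$. The universal roots $\tau_1,\dots,\tau_n$ are the classes of $t_1,\dots,t_n$; thus $f(t)=(t-\tau_1)\cdots(t-\tau_n)$ in $B_f[t]$. Action: $\mathfrak S_n$ is the group of permutations of $\{1,\dots,n\}$; each $\sigma\in\mathfrak S_n$ acts on $B_f$ by the $B$-algebra automorphism $\varphi_\sigma$ determined by $\varphi_\sigma(\tau_i)=\tau_{\sigma^{-1}(i)}$. The ring of invariants is the subring of elements fixed by all $\varphi_\sigma$. ''The ring of invariants of $B_f$ is $B$'' means that $B\to B_f$ is injective with image the ring of invariants. *)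

(* Defs.v *)
From HB Require Import structures.
From mathcomp Require Import all_boot all_fingroup all_algebra.
From mathcomp Require Import generic_quotient ring_quotient mpoly.
From mathcomp Require Import boolp.

Set Implicit Arguments.
Unset Strict Implicit.
Unset Printing Implicit Defensive.

Import GRing.Theory.
Local Open Scope ring_scope.
Local Open Scope quotient_scope.

(* The A-algebra R is presented by its structure morphism g : A -> R, so that
   the same notion applies to towers A -> B -> R. *)
Definition alg_independent (A R : comNzRingType) (g : {rmorphism A -> R})
    (n : nat) (v : 'I_n -> R) : Prop :=
  forall p : {mpoly A[n]}, mmap g v p = 0 -> p = 0.

Definition free_basis (B : comNzRingType) (M : lmodType B) (I : finType)
    (e : I -> M) : Prop :=
  (forall c : I -> B, \sum_i c i *: e i = 0 -> forall i, c i = 0) /\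
  (forall x : M, exists c : I -> B, x = \sum_i c i *: e i).

Section Adjoin.
Variables (A : comNzRingType) (C : comAlgType A) (n : nat) (f : 'I_n -> C).

Definition adjoin_pred : {pred C} :=
  fun x => `[< exists p : {mpoly A[n]}, x = mmap (in_alg C) f p >].

Lemma adjoin_predP x :
  reflect (exists p : {mpoly A[n]}, x = mmap (in_alg C) f p)
          (x \in adjoin_pred).
Proof. exact: asboolP. Qed.

Fact adjoin_subalg_closed : subalg_closed adjoin_pred.
Proof.
split.
- by apply/adjoin_predP; exists 1; rewrite rmorph1.
- move=> a x y /adjoin_predP[p ->] /adjoin_predP[q ->]; apply/adjoin_predP.
  by exists (a *: p + q); rewrite raddfD /= mmapZ /= mulr_algl.
- move=> x y /adjoin_predP[p ->] /adjoin_predP[q ->]; apply/adjoin_predP.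
  by exists (p * q); rewrite rmorphM.
Qed.

HB.instance Definition _ :=
  GRing.isSubalgClosed.Build A C adjoin_pred adjoin_subalg_closed.

(* The subalgebra A[f_1, ..., f_n] of C. *)
Record adjoin : predArgType :=
  Adjoin { adjoin_val : C; _ : adjoin_val \in adjoin_pred }.

HB.instance Definition _ := [isSub for adjoin_val].
HB.instance Definition _ := [Choice of adjoin by <:].
HB.instance Definition _ := [SubChoice_isSubAlgebra of adjoin by <:].
HB.instance Definition _ := [SubNzRing_isSubComNzRing of adjoin by <:].

Lemma adjoin_gen_proof i : f i \in adjoin_pred.
Proof. by apply/adjoin_predP; exists 'X_i; rewrite mmapX mmap1U. Qed.

Definition adjoin_gen (i : 'I_n) : adjoin := Adjoin (adjoin_gen_proof i).

End Adjoin.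

Section Viete.

Lemma mmap_mesym (B S : comNzRingType) (g : {rmorphism B -> S}) n
    (t : 'I_n -> S) k :
  mmap g t (mesym n B k) = \sum_(h : {set 'I_n} | #|h| == k) \prod_(i in h) t i.
Proof.
rewrite /mesym raddf_sum /=; apply: eq_bigr => h _.
by rewrite rmorph_prod /=; apply: eq_bigr => i _; rewrite mmapX mmap1U.
Qed.

Lemma prod_XsubC_mesym (S : comNzRingType) n (t : 'I_n -> S) :
  \prod_(i < n) ('X - (t i)%:P) =
  \sum_(k < n.+1) (-1) ^+ k *: (mmap intr t (mesym n int k) *: 'X^(n - k)).
Proof.
have /(congr1 (map_poly (mmap intr t))) := Viete n.
rewrite rmorph_prod raddf_sum /=.
under eq_bigr do rewrite rmorphB /= map_polyX map_polyC /= mmapX mmap1U.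
move=> ->; apply: eq_bigr => k _.
by rewrite !map_polyZ /= map_polyXn rmorphXn /= rmorphN1.
Qed.

End Viete.

(* The monic polynomial t^n - f_1 t^(n-1) + ... + (-1)^n f_n; indices are
   shifted, so that (f i) stands for f_(i+1). *)
Definition signed_poly (B : comNzRingType) n (f : 'I_n -> B) : {poly B} :=
  'X^n + \sum_(i < n) (-1) ^+ i.+1 *: (f i *: 'X^(n - i.+1)).

Section SplittingRing.

Lemma size_signed_poly_tail (B : comNzRingType) n (f : 'I_n -> B) :
  (size (\sum_(i < n) (-1) ^+ i.+1 *: (f i *: 'X^(n - i.+1)))%R <= n)%N.
Proof.
apply: (leq_trans (size_sum _ _ _)); apply/bigmax_leqP => i _.
apply: (leq_trans (size_scale_leq _ _)).
apply: (leq_trans (size_scale_leq _ _)).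
by rewrite size_polyXn -subSn // subSS leq_subr.
Qed.

Lemma size_signed_poly (B : comNzRingType) n (f : 'I_n -> B) :
  size (signed_poly f) = n.+1.
Proof.
by rewrite size_polyDl size_polyXn // ltnS size_signed_poly_tail.
Qed.

Lemma monic_signed_poly (B : comNzRingType) n (f : 'I_n -> B) :
  signed_poly f \is monic.
Proof.
rewrite monicE lead_coefDl ?lead_coefXn //.
by rewrite size_polyXn ltnS size_signed_poly_tail.
Qed.

Lemma coef_signed_poly (B : comNzRingType) n (f : 'I_n -> B) (i : 'I_n) :
  (signed_poly f)`_(n - i.+1) = (-1) ^+ i.+1 * f i.
Proof.
rewrite coefD coefXn ltn_eqF ?add0r; last first.
  by rewrite ltn_subrL /=; case: n i {f} => [[]|].
rewrite coef_sum (bigD1 i) //= !coefZ coefXn eqxx mulr1 big1 ?addr0 //.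
move=> j ji; rewrite !coefZ coefXn.
case: eqP => [e|_]; last by rewrite !mulr0.
case/eqP: ji; apply/val_inj/succn_inj.
by rewrite -(subKn (ltn_ord j)) -e subKn.
Qed.

Lemma horner_qX (B : comNzRingType) (h q : {poly B}) :
  (map_poly (qpolyC h) q).[qpolyX h] = in_qpoly h q.
Proof.
elim/poly_ind: q => [|q c IHq]; first by rewrite rmorph0 horner0 in_qpoly0.
rewrite rmorphD rmorphM /= map_polyX map_polyC /= hornerMXaddC IHq.
rewrite in_qpolyD in_qpolyM; congr (_ + _).
apply/val_inj; rewrite /= Pdiv.CommonRing.rmodp_small //.
exact: leq_ltn_trans (size_polyC_leq1 _) (size_mk_monic_gt1 h).
Qed.

Lemma monic_splits n (B : comNzRingType) (p : {poly B}) :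
    p \is monic -> size p = n.+1 ->
  exists (S : comNzRingType) (g : {rmorphism B -> S}) (t : 'I_n -> S),
    map_poly g p = \prod_(i < n) ('X - (t i)%:P).
Proof.
elim: n B p => [|n IHn] B p pm sp.
  exists B, idfun, (fun=> 0); rewrite big_ord0 map_poly_id //.
  by move/size1_polyC: (eq_leq sp) pm => ->; rewrite monicE lead_coefC => /eqP->.
have mkp : mk_monic p = p by rewrite /mk_monic sp pm.
pose g1 : {rmorphism B -> {poly %/ p}} := qpolyC p.
have /factor_theorem[q qE] : root (map_poly g1 p) (qpolyX p).
  apply/rootP; rewrite horner_qX; apply/val_inj => /=.
  by rewrite mkp Pdiv.RingMonic.rmodpp.
have qm : q \is monic.
  by rewrite -(monicMr _ (monicXsubC (qpolyX p))) -qE monic_map.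
have sq : size q = n.+1.
  have := congr1 (fun r : {poly {poly %/ p}} => size r) qE.
  rewrite size_map_poly_id0 ?sp; last by rewrite (monicP pm) rmorph1 oner_neq0.
  rewrite size_Mmonic ?monic_neq0 ?monicXsubC // size_XsubC addn2 /=.
  by case.
have [S [g2 [t gq]]] := IHn _ q qm sq.
exists S, (g2 \o g1), (fun i => oapp t (g2 (qpolyX p)) (unlift ord_max i)).
rewrite map_poly_comp qE rmorphM /= gq rmorphB /= map_polyX map_polyC /=.
rewrite big_ord_recr /= unlift_none; congr (_ * _).
apply: eq_bigr => i _; rewrite (_ : widen_ord _ i = lift ord_max i) ?liftK //.
by apply/val_inj; rewrite /= /bump leqNgt ltn_ord.
Qed.

End SplittingRing.

Section SplittingAlgebra.
Variables (B : comNzRingType) (n : nat) (f : 'I_n -> B).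

Definition split_ideal : {pred {mpoly B[n]}} :=
  fun p => `[< exists q : 'I_n -> {mpoly B[n]},
     p = \sum_(i < n) q i * ((mesym n B i.+1) - (f i)%:MP) >].

Lemma split_idealP p :
  reflect (exists q : 'I_n -> {mpoly B[n]},
             p = \sum_(i < n) q i * ((mesym n B i.+1) - (f i)%:MP))
          (p \in split_ideal).
Proof. exact: asboolP. Qed.

Fact split_ideal_closed : idealr_closed split_ideal.
Proof.
split.
- by apply/split_idealP; exists (fun=> 0); rewrite big1 // => i _; rewrite mul0r.
- apply/split_idealP => -[q].
  have [S [g [t gt]]] :=
    monic_splits (monic_signed_poly f) (size_signed_poly f).
  move/(congr1 (mmap g t)); rewrite rmorph1 raddf_sum /= big1.
    by apply/eqP; exact: oner_neq0.
  move=> i _; rewrite rmorphM rmorphB /= mmapC; apply/eqP.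
  suff -> : mmap g t (mesym n B i.+1) = g (f i) by rewrite subrr mulr0.
  have /(congr1 (fun p : {poly S} => p`_(n - i.+1))) := gt.
  rewrite coef_map coef_signed_poly prod_XsubC_mesym coef_sum.
  rewrite (bigD1 (lift ord0 i)) //= big1 ?addr0; last first.
    move=> j ji; rewrite !coefZ coefXn.
    case: eqP => [e|_]; last by rewrite !mulr0.
    case/eqP: ji; apply/val_inj => /=; rewrite /bump /= add1n.
    by rewrite -(subKn (ltnSE (ltn_ord j))) -e subKn.
  rewrite !coefZ /bump /= add1n coefXn eqxx mulr1 rmorphM rmorphXn rmorphN1.
  move/(congr1 ( *%R ((-1) ^+ i.+1))); rewrite !mulrA -!exprMn mulrNN mulr1.
  by rewrite expr1n !mul1r !mmap_mesym.
- move=> a p q /split_idealP[u ->] /split_idealP[v ->]; apply/split_idealP.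
  exists (fun i => a * u i + v i); rewrite mulr_sumr -big_split /=.
  by apply: eq_bigr => i _; rewrite mulrDl mulrA.
Qed.

HB.instance Definition _ :=
  isIdealr.Build {mpoly B[n]} split_ideal split_ideal_closed.

Definition split_alg : Type := {ideal_quot split_ideal}.

HB.instance Definition _ := GRing.ComNzRing.on split_alg.

Definition split_pi (p : {mpoly B[n]}) : split_alg :=
  \pi_{ideal_quot split_ideal} p.

Lemma split_pi_zmod : zmod_morphism split_pi.
Proof. exact: pi_is_zmod_morphism. Qed.

Lemma split_pi_monoid : monoid_morphism split_pi.
Proof. exact: pi_is_monoid_morphism. Qed.

HB.instance Definition _ :=
  GRing.isZmodMorphism.Build {mpoly B[n]} split_alg split_pi split_pi_zmod.
HB.instance Definition _ :=
  GRing.isMonoidMorphism.Build {mpoly B[n]} split_alg split_pi split_pi_monoid.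

Lemma split_pi_surj x : exists p, x = split_pi p.
Proof. by exists (repr (x : {ideal_quot split_ideal})); rewrite /split_pi reprK. Qed.

Lemma split_pi_eq p q : (split_pi p = split_pi q) <-> (p - q \in split_ideal).
Proof. by rewrite Quotient.idealrBE; split=> /eqP. Qed.

Definition split_scale (b : B) (x : split_alg) : split_alg :=
  split_pi b%:MP * x.

Fact split_scaleA a b x :
  split_scale a (split_scale b x) = split_scale (a * b) x.
Proof. by rewrite /split_scale mulrA -rmorphM -mpolyCM. Qed.
Fact split_scale1 : left_id 1 split_scale.
Proof. by move=> x; rewrite /split_scale rmorph1 mul1r. Qed.
Fact split_scaleDr : right_distributive split_scale +%R.
Proof. by move=> b x y; rewrite /split_scale mulrDr. Qed.
Fact split_scaleDl x : {morph split_scale^~ x : a b / a + b}.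
Proof. by move=> a b; rewrite /split_scale -mulrDl -rmorphD -mpolyCD. Qed.
Fact split_scaleAl b (x y : split_alg) :
  split_scale b (x * y) = split_scale b x * y.
Proof. exact: mulrA. Qed.

HB.instance Definition _ := GRing.Zmodule_isLmodule.Build B split_alg
  split_scaleA split_scale1 split_scaleDr split_scaleDl.
HB.instance Definition _ :=
  GRing.Lmodule_isLalgebra.Build B split_alg split_scaleAl.
HB.instance Definition _ := GRing.Lalgebra_isComAlgebra.Build B split_alg.

Lemma split_piZ b p : split_pi (b *: p) = b *: split_pi p.
Proof. by rewrite -mul_mpolyC rmorphM. Qed.

Lemma split_piC b : split_pi b%:MP = b%:A.
Proof. by rewrite -[LHS]mulr1. Qed.

(* The universal roots tau_1, ..., tau_n. *)
Definition split_root (i : 'I_n) : split_alg := split_pi 'X_i.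

Lemma split_pi_mmap p : split_pi p = mmap (in_alg split_alg) split_root p.
Proof.
rewrite {1}(mpolyE p) raddf_sum; apply: eq_bigr => m _ /=.
rewrite split_piZ mulr_algl mpolyXE_id rmorph_prod; congr (_ *: _).
by apply: eq_bigr => i _; rewrite rmorphXn.
Qed.

Lemma split_root_mesym (i : 'I_n) :
  mmap (in_alg split_alg) split_root (mesym n B i.+1) = (f i)%:A.
Proof.
rewrite -split_pi_mmap -split_piC; apply/split_pi_eq/split_idealP.
exists (fun j => (j == i)%:R); rewrite (bigD1 i) //= eqxx mul1r big1 ?addr0 //.
by move=> j /negPf ->; rewrite mul0r.
Qed.

Lemma signed_poly_split :
  map_poly (in_alg split_alg) (signed_poly f) =
  \prod_(i < n) ('X - (split_root i)%:P).
Proof.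
rewrite prod_XsubC_mesym big_ord_recl subn0 expr0 scale1r.
rewrite !mmap_mesym (big_pred1 set0) => [|h]; last by rewrite cards_eq0.
rewrite big_set0 scale1r rmorphD /= map_polyXn; congr (_ + _).
rewrite raddf_sum; apply: eq_bigr => i _ /=.
rewrite !map_polyZ map_polyXn rmorphXn rmorphN1 /= -split_root_mesym.
by rewrite /bump /= add1n !mmap_mesym.
Qed.

(* phi_sigma : tau_i |-> tau_(sigma^-1 i), induced on the quotient by the
   permutation of variables 'X_i |-> 'X_(sigma^-1 i). *)
Definition split_act (s : 'S_n) (x : split_alg) : split_alg :=
  split_pi (msym s^-1 (repr (x : {ideal_quot split_ideal}))).

Lemma msym_split_ideal (s : 'S_n) p :
  p \in split_ideal -> msym s p \in split_ideal.
Proof.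
case/split_idealP=> q ->; apply/split_idealP.
exists (fun i => msym s (q i)); rewrite raddf_sum; apply: eq_bigr => i _ /=.
rewrite rmorphM rmorphB /= (issymP _ (mesym_sym _ _ _)).
by congr (_ * (_ - _)); exact: mmapC.
Qed.

Lemma split_act_pi s p : split_act s (split_pi p) = split_pi (msym s^-1 p).
Proof.
apply/split_pi_eq; rewrite -rmorphB; apply: msym_split_ideal.
by apply/split_pi_eq; rewrite /split_pi reprK.
Qed.

Lemma split_act_root s i : split_act s (split_root i) = split_root (s^-1%g i).
Proof. by rewrite split_act_pi /msym mmapX mmap1U. Qed.

Fact split_act_zmod s : zmod_morphism (split_act s).
Proof.
move=> x y; have [p ->] := split_pi_surj x; have [q ->] := split_pi_surj y.
by rewrite -rmorphB !split_act_pi !rmorphB.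
Qed.
Fact split_act_monoid s : monoid_morphism (split_act s).
Proof.
split=> [|x y]; first by rewrite -(rmorph1 split_pi) split_act_pi !rmorph1.
have [p ->] := split_pi_surj x; have [q ->] := split_pi_surj y.
by rewrite -rmorphM !split_act_pi !rmorphM.
Qed.
Fact split_act_scalable s : scalable (split_act s).
Proof.
move=> b x; have [p ->] := split_pi_surj x.
by rewrite -split_piZ !split_act_pi msymZ split_piZ.
Qed.
HB.instance Definition _ s :=
  GRing.isZmodMorphism.Build split_alg split_alg (split_act s)
    (split_act_zmod s).
HB.instance Definition _ s :=
  GRing.isMonoidMorphism.Build split_alg split_alg (split_act s)
    (split_act_monoid s).
HB.instance Definition _ s :=
  GRing.isScalable.Build B split_alg split_alg *:%R (split_act s)
    (split_act_scalable s).

End SplittingAlgebra.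

(* Main.v *)
Require Import Defs.
From HB Require Import structures.
From mathcomp Require Import all_boot all_order all_fingroup all_algebra.
From mathcomp Require Import mpoly boolp.

Set Implicit Arguments.
Unset Strict Implicit.
Unset Printing Implicit Defensive.

Import Order.TTheory GRing.Theory.
Local Open Scope ring_scope.

(** Adjoining n universal roots to the generic polynomial gives back the
    polynomial ring T = A[X_1, ..., X_n], with the base ring
    B = A[f_1, ..., f_n] sitting in it as the ring of symmetric polynomials.
    Precisely, the map p |-> p(tau) from T to the splitting algebra S is an isomorphism:

    - it is onto, because S is generated over B by the roots and each f_i is the
      i-th elementary symmetric function e_i of the roots
      ([mmap_root_mesym], [mmap_root_surj]);
    - it is injective, because algebraic independence of the f_i allows a ring
      morphism B -> T with f_i |-> e_i; sending each root to X_i kills the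
      relations that define S, so it recovers p from p(tau)
      ([mmap_root_inj]).

    Injectivity is statement (2).  The isomorphism commutes with the
    permutations, and by the fundamental theorem on symmetric polynomials B
    corresponds to the symmetric polynomials; this is statement (1).

    For (3) it remains to see that the monomials X^m with m_i < i form a basis
    of T over the symmetric polynomials.  Let U_k be the subring of T generated by
    the symmetric polynomials and the variables of 0-based index at least k, so
    that U_0 = T and U_n is the ring of symmetric polynomials.  Then
    1, x, ..., x^k, for x the variable of index k, is a basis of U_k over
    U_(k+1):

    - it spans, since x is a root of the product of the 'X - 'X_i over i <= k, a
      monic polynomial of degree k+1 with coefficients in U_(k+1)
      ([head_poly_over], [tail_ring_span]);
    - it is free, since the transposition of the indices i and k fixes U_(k+1)
      when i <= k: it turns a relation satisfied by x into the same relation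
      satisfied by 'X_i.  A polynomial of degree at most k would thus have the
      k+1 roots 'X_0, ..., 'X_k, whose differences are regular, so it is zero
      ([tail_ring_free]).

    Multiplying these bases along the tower U_0, ..., U_n gives the monomials
    ([tower_span], [tower_free]). *)

(** * Monomial bases in towers of subrings *)

Notation stair_exponents n := {dffun forall i : 'I_n, 'I_i.+1}.

Section Tower.
Variables (R : comNzRingType) (n : nat) (x : 'I_n -> R).

Local Notation expo := (stair_exponents n).

Definition expo_below (k : nat) (m : expo) : bool :=
  [forall i : 'I_n, (k <= i)%N ==> (m i == 0%N :> nat)].

(** The update is computed on natural numbers and cast back by [inord], which
    avoids transporting j along the equality i = k; it is meaningful only for
    j <= k. *)
Definition expo_set (m : expo) (k : 'I_n) (j : nat) : expo :=
  [ffun i : 'I_n => inord (if i == k then j else m i)].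

Definition stair_monomial (m : expo) : R := \prod_(i < n) x i ^+ m i.

Lemma expo_belowP k (m : expo) :
  reflect (forall i : 'I_n, (k <= i)%N -> m i = 0%N :> nat) (expo_below k m).
Proof.
apply: (iffP forallP) => h i; first by move=> ki; apply/eqP/(implyP (h i)).
by apply/implyP=> ki; apply/eqP/h.
Qed.

Lemma expo_below0 (m : expo) : expo_below 0 m = (m == [ffun=> ord0]).
Proof.
apply/expo_belowP/eqP => [m0|-> i _]; last by rewrite ffunE.
by apply/ffunP => i; apply/val_inj; rewrite ffunE /= m0.
Qed.

Lemma expo_below_full (m : expo) : expo_below n m.
Proof. by apply/expo_belowP => i; rewrite leqNgt ltn_ord. Qed.

Lemma expo_setE (m : expo) (k i : 'I_n) j : (j <= k)%N ->
  expo_set m k j i = (if i == k then j else m i) :> nat.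
Proof.
by move=> jk; rewrite ffunE inordK //; case: (i =P k) => [->|].
Qed.

Lemma expo_below_set (m : expo) (k : 'I_n) j : (j <= k)%N ->
  expo_below k m -> expo_below k.+1 (expo_set m k j).
Proof.
move=> jk /expo_belowP mk; apply/expo_belowP => i ki.
rewrite expo_setE //; case: (i =P k) ki => [->|_ ki]; first by rewrite ltnn.
by rewrite mk // ltnW.
Qed.

Lemma expo_set_below (m : expo) (k : 'I_n) :
  expo_below k.+1 m -> expo_below k (expo_set m k 0).
Proof.
move=> /expo_belowP mk; apply/expo_belowP => i ki.
rewrite expo_setE //; case: (i =P k) => // /eqP ik.
by rewrite mk // ltn_neqAle eq_sym ik.
Qed.

Lemma expo_setK (m : expo) (k : 'I_n) j : (j <= k)%N ->
  expo_set (expo_set m k 0) k j = expo_set m k j.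
Proof.
move=> jk; apply/ffunP => i; apply/val_inj => /=.
by rewrite !expo_setE //; case: eqP.
Qed.

Lemma expo_set_id (m : expo) (k : 'I_n) : expo_set m k (m k) = m.
Proof.
apply/ffunP => i; apply/val_inj; rewrite /= expo_setE -1?ltnS ?ltn_ord //.
by case: (i =P k) => [->|].
Qed.

Lemma expo_setK0 (m : expo) (k : 'I_n) j : (j <= k)%N -> expo_below k m ->
  expo_set (expo_set m k j) k 0 = m.
Proof.
move=> jk /expo_belowP mk; apply/ffunP => i; apply/val_inj => /=.
by rewrite !expo_setE //; case: (i =P k) => [->|] //; rewrite mk.
Qed.

(** Exponents supported below k.+1 are the pairs of an exponent supported below
    k and a value at k; this is what makes induction on k possible. *)
Lemma sum_expo_below (V : nmodType) (k : 'I_n) (F : expo -> V) :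
  \sum_(m | expo_below k.+1 m) F m =
  \sum_(m | expo_below k m) \sum_(j < k.+1) F (expo_set m k j).
Proof.
rewrite pair_big_dep /=.
rewrite (reindex_onto (fun mj : expo * 'I_k.+1 => expo_set mj.1 k mj.2)
          (fun m => (expo_set m k 0, m k))) /=; last first.
  by move=> m _; rewrite expo_setK ?expo_set_id // -ltnS ltn_ord.
apply: eq_bigl => -[m j] /=; rewrite andbT.
have jk : (j <= k)%N by rewrite -ltnS.
apply/andP/idP => [[mk /eqP[mE _]]|mk]; first by rewrite -mE expo_set_below.
split; first exact: expo_below_set.
apply/eqP; congr (_, _).
  exact: expo_setK0.
by apply/val_inj; rewrite /= expo_setE // eqxx.
Qed.

Lemma stair_monomial_set (m : expo) (k : 'I_n) j : (j <= k)%N ->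
  expo_below k m ->
  stair_monomial (expo_set m k j) = x k ^+ j * stair_monomial m.
Proof.
move=> jk /expo_belowP mk; rewrite /stair_monomial (bigD1 k) //=.
rewrite [in RHS](bigD1 k) //= mk // expr0 mul1r expo_setE // eqxx.
by congr (_ * _); apply: eq_bigr => i /negPf ik; rewrite expo_setE // ik.
Qed.

Lemma sum_stair_step (k : 'I_n) (c : expo -> R) :
  \sum_(m | expo_below k.+1 m) c m * stair_monomial m =
  \sum_(m | expo_below k m)
    (\sum_(j < k.+1) c (expo_set m k j) * x k ^+ j) * stair_monomial m.
Proof.
rewrite sum_expo_below; apply: eq_bigr => m mk.
rewrite mulr_suml; apply: eq_bigr => j _.
by rewrite stair_monomial_set ?mulrA // -ltnS.
Qed.

(** [U] stands for a decreasing tower of subrings. *)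
Variable U : nat -> R -> Prop.

(** Expanding the coefficients of U_k in powers of x_k over U_(k+1), for
    k = 0, 1, ..., brings in the factors x_k ^+ m_k one at a time. *)
Lemma tower_span :
    (forall (k : 'I_n) y, U k y -> exists d : nat -> R,
       (forall j, U k.+1 (d j)) /\ y = \sum_(j < k.+1) d j * x k ^+ j) ->
  forall y, U 0 y -> exists c : expo -> R,
    (forall m, U n (c m)) /\ y = \sum_m c m * stair_monomial m.
Proof.
move=> stepU y Uy.
have span k : (k <= n)%N -> exists c : expo -> R, (forall m, U k (c m)) /\
    y = \sum_(m | expo_below k m) c m * stair_monomial m.
  elim: k => [|k IHk] kn.
    exists (fun=> y); split => //; rewrite (eq_bigl _ _ expo_below0).
    rewrite big_pred1_eq /stair_monomial big1 ?mulr1 // => i _.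
    by rewrite ffunE.
  have [c [Uc yE]] := IHk (ltnW kn); pose K := Ordinal kn.
  have [d dP] := choice (fun m => stepU K _ (Uc m)).
  (* The new coefficient at m is read off the expansion of the old one at the
     exponent that m has below k. *)
  exists (fun m => d (expo_set m K 0) (m K)); split=> [m|].
    by case: (dP (expo_set m K 0)).
  rewrite (sum_stair_step K) yE; apply: eq_bigr => m mk; congr (_ * _).
  rewrite (dP m).2; apply: eq_bigr => j _; rewrite expo_setE -1?ltnS // eqxx.
  by rewrite expo_setK0 // -ltnS.
have [c [Uc ->]] := span n (leqnn n); exists c; split => //.
by apply: eq_bigl => m; rewrite expo_below_full.
Qed.

(** A relation supported below k.+1, grouped by powers of x_k, is a relation
    supported below k with coefficients in U_k.  These vanish by induction, and
    freeness of the powers of x_k over U_(k+1) finishes. *)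
Lemma tower_free :
    (forall (k : 'I_n) (d : nat -> R), (forall j, U k.+1 (d j)) ->
       U k (\sum_(j < k.+1) d j * x k ^+ j)) ->
    (forall (k : 'I_n) (d : nat -> R), (forall j, U k.+1 (d j)) ->
       \sum_(j < k.+1) d j * x k ^+ j = 0 -> forall j : 'I_k.+1, d j = 0) ->
  forall c : expo -> R, (forall m, U n (c m)) ->
    \sum_m c m * stair_monomial m = 0 -> forall m, c m = 0.
Proof.
move=> subU freeU c Uc sum0.
have free k : (k <= n)%N -> forall c : expo -> R, (forall m, U k (c m)) ->
    \sum_(m | expo_below k m) c m * stair_monomial m = 0 ->
    forall m, expo_below k m -> c m = 0.
  elim: k => [|k IHk] kn {}c {}Uc {}sum0 m mk.
    move: sum0; rewrite (eq_bigl _ _ expo_below0) big_pred1_eq.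
    rewrite /stair_monomial big1 => [|i _]; last by rewrite ffunE.
    by rewrite mulr1; move: mk; rewrite expo_below0 => /eqP ->.
  pose K := Ordinal kn; rewrite (sum_stair_step K) in sum0.
  pose d m' j := c (expo_set m' K j).
  have /(_ (expo_set m K 0) (expo_set_below (k := K) mk)) :=
    IHk (ltnW kn) _ (fun m' => subU K (d m') (fun j => Uc _)) sum0.
  move/(freeU K (d _) (fun j => Uc _))/(_ (m K)).
  by rewrite /d expo_setK ?expo_set_id // -ltnS ltn_ord.
move=> m; apply: (free n) (expo_below_full m) => //.
by rewrite -{}[RHS]sum0; apply: eq_bigl => m'; rewrite expo_below_full.
Qed.

End Tower.

(** * Univariate polynomials over a ring with zero divisors *)

Section Univariate.
Variable R : comNzRingType.

(** Over a ring with zero divisors, distinctness of the roots does not bound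
    their number; cancelling the differences is what the induction on linear
    factors uses. *)
Lemma poly_roots_lreg k (p : {poly R}) (r : 'I_k -> R) :
    (size p <= k)%N -> (forall i, root p (r i)) ->
    (forall i j, i != j -> GRing.lreg (r i - r j)) ->
  p = 0.
Proof.
elim: k p r => [|k IHk] p r sp rp reg.
  by apply/eqP; rewrite -size_poly_leq0.
have /factor_theorem[q pE] := rp ord0.
suff q0 : q = 0 by rewrite pE q0 mul0r.
apply: (IHk q (fun i => r (lift ord0 i))) => [|i|i j ij]; last 1 first.
- by apply: reg; rewrite (inj_eq lift_inj).
- have [->|q0] := eqVneq q 0; first by rewrite size_poly0.
  move: sp; rewrite pE size_Mmonic ?monicXsubC // size_XsubC addn2 /=.
  by rewrite ltnS.
have := rp (lift ord0 i); rewrite !rootE pE hornerM hornerXsubC mulrC.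
by rewrite mulrI_eq0 //; apply: reg; rewrite eq_sym neq_lift.
Qed.

Variable U : subringClosed R.

(** Synthetic division: the coefficients of the quotient are computed from the
    top down, by q_j = (q ('X - a))_(j+1) + a q_(j+1). *)
Lemma polyOver_divXsubC (a : R) (q : {poly R}) :
  a \in U -> q * ('X - a%:P) \is a polyOver U -> q \is a polyOver U.
Proof.
move=> Ua /polyOverP Uqa; apply/polyOverP => j.
have [d] := ubnP (size q - j); elim: d j => // d IHd j.
rewrite ltnS => jd; have [sj|js] := leqP (size q) j.
  by rewrite nth_default ?rpred0.
have -> : q`_j = (q * ('X - a%:P))`_j.+1 + q`_j.+1 * a.
  by rewrite mulrBr coefB coefMX coefMC subrK.
by rewrite rpredD ?rpredM // IHd // (leq_trans _ jd) // subnS prednK ?subn_gt0.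
Qed.

(** Subtracting a multiple of h at each step of the Horner scheme of q keeps the
    degree below that of h and the coefficients in U. *)
Lemma polyOver_reduce (h q : {poly R}) (a : R) :
    h \is monic -> h \is a polyOver U -> root h a -> q \is a polyOver U ->
  exists r : {poly R},
    [/\ r \is a polyOver U, (size r < size h)%N & r.[a] = q.[a]].
Proof.
move=> hm Uh /rootP ha; have h_gt1 : (1 < size h)%N.
  rewrite ltnNge; apply/negP => /size1_polyC hC; move: ha hm.
  rewrite hC hornerC => ->; rewrite monicE lead_coefC eq_sym.
  by rewrite (negPf (oner_neq0 R)).
elim/poly_ind: q => [_|q c IHq Uqc].
  by exists 0; rewrite rpred0 size_poly0 (ltnW h_gt1).
have qcE j : (q * 'X + c%:P)`_j = if j is i.+1 then q`_i else c.
  by rewrite coefD coefMX coefC; case: j => [|j]; rewrite ?add0r ?addr0.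
have Uc : c \in U by rewrite -[c](qcE 0) (polyOverP Uqc).
have [|r [Ur sr ra]] := IHq.
  by apply/polyOverP => j; rewrite -[_`_j](qcE j.+1) (polyOverP Uqc).
(* The coefficient that r * 'X puts in the degree of h. *)
pose b := r`_(size h).-2.
exists (r * 'X + c%:P - b%:P * h); split.
- by rewrite rpredB ?rpredD ?rpredM ?polyOverX ?polyOverC ?(polyOverP Ur).
- rewrite -(ltn_predK h_gt1) ltnS; apply/leq_sizeP => j hj.
  have j_gt0 : (0 < j)%N by apply: leq_trans hj; rewrite -subn1 subn_gt0.
  rewrite coefB coefD coefMX coefC coefCM gtn_eqF // addr0.
  have [jE|jh] := eqVneq j (size h).-1.
    by rewrite jE -lead_coefE (monicP hm) mulr1 subrr.
  have hj1 : (size h <= j)%N.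
    by rewrite -(ltn_predK h_gt1) ltn_neqAle eq_sym jh.
  rewrite [h`_j]nth_default // mulr0 subr0 nth_default //.
  by rewrite -ltnS prednK // (leq_trans sr).
by rewrite !hornerE ha ra mulr0 subr0.
Qed.

End Univariate.

(** * Polynomials over the symmetric polynomials *)

Section SymmetricTower.
Variables (A : comNzRingType) (n : nat).
Local Notation T := {mpoly A[n]}.

(** The leading coefficient is 1 or -1, hence regular whatever the ring A. *)
Lemma lreg_XsubX (i j : 'I_n) : i != j -> GRing.lreg ('X_i - 'X_j : T).
Proof.
move=> ij; apply: lreg_mleadc.
rewrite mleadD ?mleadN !mleadXm ?eq_mnm1 //.
case: leP => _; rewrite mcoeffB !mcoeffXU eqxx.
  by rewrite (negPf ij) sub0r; apply/lregN/lreg1.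
by rewrite eq_sym (negPf ij) subr0; apply: lreg1.
Qed.

(** The subring generated by the symmetric polynomials and the variables of
    index at least k.  Closure under opposite follows from multiplication by the
    symmetric polynomial -1.  Being inductive, it gives at once both the
    invariance and the generation by 'X_k over the next ring. *)
Inductive tail_span (k : nat) : T -> Prop :=
| tail_sym p of p \is symmetric : tail_span k p
| tail_var (i : 'I_n) of (k <= i)%N : tail_span k 'X_i
| tail_add p q of tail_span k p & tail_span k q : tail_span k (p + q)
| tail_mul p q of tail_span k p & tail_span k q : tail_span k (p * q).

Definition tail_ring (k : nat) : {pred T} := fun p => `[< tail_span k p >].

Lemma tail_ringP k p : reflect (tail_span k p) (p \in tail_ring k).
Proof. exact: asboolP. Qed.

Fact tail_ring_subring_closed k : subring_closed (tail_ring k).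
Proof.
split=> [|p q|p q] /=; first by apply/tail_ringP/tail_sym/rpred1.
- move=> /tail_ringP pk /tail_ringP qk; apply/tail_ringP/tail_add => //.
  rewrite -mulN1r; apply: tail_mul => //; apply: tail_sym.
  by rewrite rpredN rpred1.
by move=> /tail_ringP pk /tail_ringP qk; apply/tail_ringP/tail_mul.
Qed.

HB.instance Definition _ k :=
  GRing.isSubringClosed.Build T (tail_ring k) (tail_ring_subring_closed k).

Lemma tail_ring_sym k p : p \is symmetric -> p \in tail_ring k.
Proof. by move=> ps; apply/tail_ringP/tail_sym. Qed.

Lemma tail_ring_var k (i : 'I_n) : (k <= i)%N -> 'X_i \in tail_ring k.
Proof. by move=> ki; apply/tail_ringP/tail_var. Qed.

Lemma tail_ringS k p : p \in tail_ring k.+1 -> p \in tail_ring k.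
Proof.
move/tail_ringP; elim=> {p} [p ps|i ki|p q _ + _|p q _ + _].
- exact: tail_ring_sym.
- exact/tail_ring_var/ltnW.
- exact: rpredD.
- exact: rpredM.
Qed.

Lemma tail_ring0 p : p \in tail_ring 0.
Proof.
rewrite (mpolyE p) rpred_sum // => m _; rewrite -mul_mpolyC rpredM //.
  by apply: tail_ring_sym; apply/issymP => s; apply: mmapC.
rewrite mpolyXE_id rpred_prod // => i _.
exact/rpredX/tail_ring_var.
Qed.

Lemma tail_ring_full p : p \in tail_ring n -> p \is symmetric.
Proof.
move/tail_ringP; elim=> {p} [//|i ni|p q _ + _|p q _ + _].
- by rewrite leqNgt ltn_ord in ni.
- exact: rpredD.
- exact: rpredM.
Qed.

Lemma msym_var s i : msym s ('X_i : T) = 'X_(s i).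
Proof. by rewrite /msym mmapX mmap1U. Qed.

Lemma tail_ring_fix k p (s : 'S_n) :
    p \in tail_ring k -> (forall i : 'I_n, (k <= i)%N -> s i = i) ->
  msym s p = p.
Proof.
move=> + fix_s; move/tail_ringP.
elim=> {p} [p|i ki|p q _ IHp _ IHq|p q _ IHp _ IHq].
- by move/issymP.
- by rewrite msym_var fix_s.
- by rewrite msymD IHp IHq.
- by rewrite msymM IHp IHq.
Qed.

Definition head_poly (k : nat) : {poly T} :=
  \prod_(i < n | (i < k)%N) ('X - ('X_i)%:P).

Lemma head_polyS (k : 'I_n) :
  head_poly k.+1 = head_poly k * ('X - ('X_k)%:P).
Proof.
rewrite /head_poly (bigD1 k) //= mulrC; congr (_ * _).
by apply: eq_bigl => i; rewrite ltnS ltn_neqAle andbC.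
Qed.

Lemma monic_head_poly k : head_poly k \is monic.
Proof. by apply: monic_prod => i _; apply: monicXsubC. Qed.

Lemma size_head_poly k : (k <= n)%N -> size (head_poly k) = k.+1.
Proof.
elim: k => [_|k IHk kn].
  by rewrite /head_poly big_pred0 ?size_poly1.
rewrite (head_polyS (Ordinal kn)) size_Mmonic ?monicXsubC //=.
  by rewrite size_XsubC IHk 1?ltnW // addn2.
by rewrite monic_neq0 ?monic_head_poly.
Qed.

(** By descending induction on k: for k = n the coefficients are symmetric, and
    each division by 'X - 'X_k only adds 'X_k to the subring. *)
Lemma head_poly_over k : (k <= n)%N -> head_poly k \is a polyOver (tail_ring k).
Proof.
move=> /subKn <-; elim: (n - k)%N => [|d IHd].
  rewrite subn0; apply/polyOverP => j; apply/tail_ring_sym/issymP => s.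
  have hE : head_poly n = \prod_i ('X - ('X_i)%:P).
    by apply: eq_bigl => i; rewrite ltn_ord.
  rewrite -coef_map; congr ((_ : {poly T})`_j); rewrite hE rmorph_prod /=.
  rewrite [RHS](reindex_inj (@perm_inj _ s)); apply: eq_bigr => i _.
  by rewrite rmorphB /= map_polyX map_polyC /= msym_var.
have [nd|dn] := leqP n d.
  by rewrite (eqP (leqW nd)); rewrite (eqP nd) in IHd.
have kn : (n - d.+1 < n)%N by rewrite ltn_subrL (leq_ltn_trans _ dn).
have kE : (n - d = (Ordinal kn).+1)%N by rewrite /= subnSK.
apply: (@polyOver_divXsubC _ _ 'X_(Ordinal kn)); first exact: tail_ring_var.
rewrite -(head_polyS (Ordinal kn)) -kE; apply: polyOverS IHd => p; rewrite kE.
exact: tail_ringS.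
Qed.

Lemma tail_ring_horner (k : 'I_n) p : p \in tail_ring k ->
  exists2 q : {poly T}, q \is a polyOver (tail_ring k.+1) & p = q.['X_k].
Proof.
move/tail_ringP; elim=> {p} [p ps|i ki|p q _ [u Uu ->] _ [v Uv ->]|
                             p q _ [u Uu ->] _ [v Uv ->]].
- by exists p%:P; rewrite ?hornerC // polyOverC tail_ring_sym.
- have [->|ik] := eqVneq i k; first by exists 'X; rewrite ?polyOverX ?hornerX.
  exists ('X_i)%:P; rewrite ?hornerC // polyOverC tail_ring_var //.
  by rewrite ltn_neqAle eq_sym ik.
- by exists (u + v); rewrite ?rpredD // hornerD.
- by exists (u * v); rewrite ?rpredM // hornerM.
Qed.

(** Modulo the monic [head_poly k.+1], which has root 'X_k, any polynomial
    expression in 'X_k reduces to one of degree at most k. *)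
Lemma tail_ring_span (k : 'I_n) p : p \in tail_ring k ->
  exists d : nat -> T, (forall j, d j \in tail_ring k.+1) /\
    p = \sum_(j < k.+1) d j * 'X_k ^+ j.
Proof.
case/tail_ring_horner => q Uq ->.
have hk : root (head_poly k.+1) 'X_k.
  by rewrite head_polyS rootE hornerM hornerXsubC subrr mulr0.
have [r [Ur sr <-]] := polyOver_reduce (monic_head_poly k.+1)
  (head_poly_over (ltn_ord k)) hk Uq.
exists (fun j => r`_j); split; first exact/polyOverP.
by apply: horner_coef_wide; rewrite -ltnS -(size_head_poly (ltn_ord k)).
Qed.

(** For i <= k the transposition (i k) fixes the coefficients d_j, so the
    relation for 'X_k also holds for 'X_i: the polynomial with coefficients d_j has one
    root more than its degree allows. *)
Lemma tail_ring_free (k : 'I_n) (d : nat -> T) :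
    (forall j, d j \in tail_ring k.+1) ->
    \sum_(j < k.+1) d j * 'X_k ^+ j = 0 ->
  forall j : 'I_k.+1, d j = 0.
Proof.
move=> Ud d0 j; pose p := \poly_(j < k.+1) d j.
suff /(congr1 (fun q : {poly T} => q`_j)) : p = 0.
  by rewrite coef_poly ltn_ord coef0.
pose r (i : 'I_k.+1) : T := 'X_(widen_ord (ltn_ord k) i).
apply: (@poly_roots_lreg _ k.+1 p r) => [|i|i i' ii']; last 1 first.
- exact: lreg_XsubX.
- exact: size_poly.
pose s := tperm k (widen_ord (ltn_ord k) i).
have := congr1 (msym s) d0; rewrite msym0 raddf_sum /= => sd0.
apply/rootP; rewrite horner_poly; apply: etrans sd0; apply: eq_bigr => l _.
rewrite msymM rmorphXn /= msym_var tpermL (tail_ring_fix (Ud l)) // => m km.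
rewrite tpermD // -val_eqE /= neq_ltn ?km //.
by rewrite (leq_ltn_trans (ltnSE (ltn_ord i)) km).
Qed.

Lemma symmetric_stair_free (c : stair_exponents n -> T) :
    (forall m, c m \is symmetric) ->
    \sum_m c m * stair_monomial (fun i => 'X_i) m = 0 ->
  forall m, c m = 0.
Proof.
move=> cs; pose U k (p : T) := p \in tail_ring k : Prop.
apply: (@tower_free _ _ _ U) => [k d Ud|k d|m].
- rewrite /U rpred_sum // => j _; apply: rpredM; last first.
    exact/rpredX/tail_ring_var.
  exact/tail_ringS/Ud.
- exact: tail_ring_free.
- exact/tail_ring_sym/cs.
Qed.

Lemma symmetric_stair_span (p : T) :
  exists c : stair_exponents n -> T, (forall m, c m \is symmetric) /\
    p = \sum_m c m * stair_monomial (fun i => 'X_i) m.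
Proof.
pose U k (p : T) := p \in tail_ring k : Prop.
have [||c [Uc ->]] := @tower_span _ _ (fun i => 'X_i) U _ p.
- exact: tail_ring_span.
- exact: tail_ring0.
by exists c; split=> // m; apply/tail_ring_full/Uc.
Qed.

End SymmetricTower.

(** * The splitting algebra of the generic polynomial *)

(** Two ring morphisms out of {mpoly R[n]} agree when they agree on constants
    and on variables; most comparisons of evaluations below are instances. *)
Lemma rmorph_mmap (R S S' : comNzRingType) n (g : {rmorphism S -> S'})
    (h : {rmorphism R -> S}) (h' : {rmorphism R -> S'})
    (x : 'I_n -> S) (x' : 'I_n -> S') (p : {mpoly R[n]}) :
    (forall a, g (h a) = h' a) -> (forall i, g (x i) = x' i) ->
  g (mmap h x p) = mmap h' x' p.
Proof.
move=> gh gx; rewrite /mmap rmorph_sum /=; apply: eq_bigr => m _.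
rewrite rmorphM gh /mmap1 rmorph_prod; congr (_ * _).
by apply: eq_bigr => i _; rewrite rmorphXn gx.
Qed.

(** The base ring B is kept abstract: a polynomial ring over A, given by
    algebraically independent generators. *)
Section GenericSplitting.
Variables (A : comNzRingType) (B : comAlgType A) (n : nat) (g : 'I_n -> B).

Local Notation T := {mpoly A[n]}.
Local Notation ev := (mmap (in_alg B) g).
Local Notation e := [tuple mesym n A i.+1 | i < n].

Hypothesis g_indep : alg_independent (in_alg B) g.
Hypothesis g_gen : forall b, exists q : T, b = ev q.

Lemma indep_inj : injective ev.
Proof. exact/raddf_inj/g_indep. Qed.

(** The universal property of a polynomial ring, for B. *)
Lemma indep_eval_morph (R : comNzRingType) (k : {rmorphism A -> R})
    (t : 'I_n -> R) :
  exists h : {rmorphism B -> R}, forall q : T, h (ev q) = mmap k t q.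
Proof.
have [inv invE] := choice g_gen.
pose h b := mmap k t (inv b).
have hE q : h (ev q) = mmap k t q.
  by rewrite /h; congr (mmap _ _ _); apply: indep_inj; rewrite -invE.
have hB : zmod_morphism h.
  by move=> b c; rewrite (invE b) (invE c) -rmorphB !hE rmorphB.
have hM : monoid_morphism h.
  split=> [|b c]; first by rewrite -(rmorph1 ev) hE rmorph1.
  by rewrite (invE b) (invE c) -rmorphM !hE rmorphM.
pose H : {rmorphism B -> R} := HB.pack h
  (GRing.isZmodMorphism.Build _ _ h hB) (GRing.isMonoidMorphism.Build _ _ h hM).
by exists H.
Qed.

Let S : comAlgType B := split_alg g.
Let tau : 'I_n -> S := split_root g.

Local Notation Phi := (mmap (in_alg S \o in_alg B) tau).

(** The morphism h : B -> T with g_i |-> e_i and the substitution of the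
    variables for the roots together send the generators of the ideal defining S
    to 0.  If p vanishes at the roots, then its image P over B lies in that
    ideal, so it is sent to 0; but it is sent to p. *)
Lemma mmap_root_inj : injective Phi.
Proof.
apply: raddf_inj => p Phi0.
pose P : {mpoly B[n]} := mmap (@mpolyC n B \o in_alg B) (fun i => 'X_i) p.
have : split_pi g P = split_pi g 0.
  rewrite rmorph0 -[RHS]Phi0.
  by apply: (rmorph_mmap (g := split_pi g)) => // a; rewrite /= split_piC.
move/split_pi_eq; rewrite subr0 => /split_idealP[q PE].
have [h hE] := indep_eval_morph (@mpolyC n A) (tnth e).
have hgen i : h (g i) = mesym n A i.+1.
  by have := hE 'X_i; rewrite !mmapX !mmap1U tnth_mktuple.
have halg a : h (a%:A) = a%:MP by have := hE a%:MP; rewrite !mmapC.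
transitivity (mmap h (fun i => 'X_i) P).
  rewrite -[LHS]comp_mpoly_id; symmetry.
  apply: (rmorph_mmap (g := mmap h (fun i : 'I_n => ('X_i : T)))) => [a|i] /=.
    by rewrite mmapC; exact: halg.
  by rewrite mmapX mmap1U tnth_mktuple.
rewrite PE rmorph_sum big1 // => i _.
by rewrite rmorphM rmorphB /= mmapC /= hgen mmap_mesym subrr mulr0.
Qed.

(** By the relations of Viete, the isomorphism carries the symmetric polynomial
    q(e_1, ..., e_n) to the scalar q(g_1, ..., g_n). *)
Lemma mmap_root_mesym (q : T) : Phi (q \mPo e) = (ev q)%:A.
Proof.
transitivity (mmap (in_alg S \o in_alg B) (fun i => (g i)%:A : S) q).
  apply: (rmorph_mmap (g := Phi)) => [a|i]; first by rewrite /= mmapC.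
  rewrite tnth_mktuple; apply: etrans (mmap_mesym _ _ _) _.
  by rewrite -split_root_mesym mmap_mesym.
by symmetry; apply: (rmorph_mmap (g := in_alg S)).
Qed.

(** S is generated by the roots over B, and the scalars from B are themselves
    symmetric functions of the roots. *)
Lemma mmap_root_surj (x : S) : exists p, x = Phi p.
Proof.
have /choice[q qE] : forall b : B, exists q : T, b%:A = Phi q.
  move=> b; have [q ->] := g_gen b; exists (q \mPo e).
  by rewrite mmap_root_mesym.
have [P ->] := split_pi_surj x; rewrite split_pi_mmap.
exists (\sum_(m <- msupp P) q P@_m * 'X_[m]); rewrite rmorph_sum.
by apply: eq_bigr => m _; rewrite rmorphM /= mmapX -qE.
Qed.

Lemma split_act_mmap_root (s : 'S_n) (p : T) :
  split_act s (Phi p : S) = Phi (msym s^-1 p).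
Proof.
transitivity (mmap (in_alg S \o in_alg B) (fun i => tau (s^-1%g i)) p).
  apply: (rmorph_mmap (g := split_act (f := g) s)) => [a|i] /=.
    by rewrite linearZ rmorph1.
  exact: split_act_root.
symmetry; apply: (rmorph_mmap (g := Phi)) => [a|i] /=; first by rewrite mmapC.
by rewrite mmapX mmap1U.
Qed.

Lemma split_scalar_inj : injective (in_alg S).
Proof.
move=> b c; have [p ->] := g_gen b; have [q ->] := g_gen c.
by rewrite /= -!mmap_root_mesym => /mmap_root_inj/msym_fundamental_un ->.
Qed.

Lemma split_invariantsP (x : S) :
  (forall s : 'S_n, split_act s x = x) <-> (exists b : B, x = b%:A).
Proof.
split=> [fix_x|[b ->] s]; last by rewrite linearZ /= rmorph1.
have [p xE] := mmap_root_surj x; rewrite xE in fix_x *.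
have /sym_fundamental[t [<- _]] : p \is symmetric.
  apply/issymP => s; apply: mmap_root_inj.
  by rewrite -{1}[s]invgK -split_act_mmap_root fix_x.
by exists (ev t); rewrite mmap_root_mesym.
Qed.

(** The factor of index 0 may be dropped because its exponent lies in 'I_1. *)
Lemma mmap_root_stair (m : stair_exponents n) :
  Phi (stair_monomial (fun i => 'X_i) m) =
  \prod_(i < n | (0 < i)%N) tau i ^+ m i.
Proof.
rewrite rmorph_prod [RHS]big_mkcond; apply: eq_bigr => i _.
rewrite rmorphXn /= mmapX mmap1U; case: ifPn => //; rewrite -eqn0Ngt => /eqP i0.
suff -> : m i = 0%N :> nat by [].
by apply/eqP; rewrite -leqn0 -[X in (_ <= X)%N]i0 -ltnS.
Qed.

(** Transport of the basis of T over the symmetric polynomials along the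
    isomorphism, under which those polynomials become the scalars. *)
Lemma split_stair_basis :
  free_basis (fun m : stair_exponents n =>
    \prod_(i < n | (0 < i)%N) tau i ^+ m i).
Proof.
have [q qE] := choice g_gen.
have Phi_sum (d : stair_exponents n -> T) (c : stair_exponents n -> B) :
    (forall m, Phi (d m) = (c m)%:A) ->
    Phi (\sum_m d m * stair_monomial (fun i => 'X_i) m) =
    \sum_m c m *: \prod_(i < n | (0 < i)%N) tau i ^+ m i.
  move=> dc; rewrite rmorph_sum; apply: eq_bigr => m _.
  by rewrite rmorphM /= dc mmap_root_stair mulr_algl.
split=> [c sum0 m|x].
  have dc m' : Phi (q (c m') \mPo e) = (c m')%:A.
    by rewrite mmap_root_mesym -qE.
  rewrite -(Phi_sum _ _ dc) -(rmorph0 Phi) in sum0.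
  apply: split_scalar_inj; rewrite /= -dc scale0r.
  rewrite (symmetric_stair_free _ (mmap_root_inj sum0) m) ?rmorph0 // => m'.
  apply: mcomp_sym => i; rewrite -tnth_nth tnth_mktuple; exact: mesym_sym.
have [p ->] := mmap_root_surj x.
have [d [d_sym ->]] := symmetric_stair_span p.
have /choice[c dc] : forall m, exists b : B, Phi (d m) = b%:A.
  move=> m; have [t [<- _]] := sym_fundamental (d_sym m).
  by exists (ev t); apply: mmap_root_mesym.
by exists c; apply: Phi_sum.
Qed.

End GenericSplitting.

Section AdjoinEval.
Variables (A : comNzRingType) (C : comAlgType A) (n : nat) (f : 'I_n -> C).

Lemma adjoin_val_mmap (q : {mpoly A[n]}) :
  val (mmap (in_alg (adjoin f)) (adjoin_gen f) q) = mmap (in_alg C) f q.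
Proof.
by apply: (rmorph_mmap (g := val : {rmorphism adjoin f -> C})).
Qed.

Lemma adjoin_gen_surj (b : adjoin f) :
  exists q, b = mmap (in_alg (adjoin f)) (adjoin_gen f) q.
Proof.
case: b => x xA; have /adjoin_predP[q xq] := xA.
by exists q; apply: val_inj; rewrite adjoin_val_mmap.
Qed.

Lemma adjoin_gen_indep : alg_independent (in_alg C) f ->
  alg_independent (in_alg (adjoin f)) (adjoin_gen f).
Proof.
by move=> f_indep q /(congr1 val); rewrite adjoin_val_mmap rmorph0 => /f_indep.
Qed.

End AdjoinEval.

Theorem theorem2p4 (A : comNzRingType) (C : comAlgType A) (n : nat)
    (f : 'I_n -> C) (n_gt0 : (0 < n)%N)
    (f_indep : alg_independent (in_alg C) f) :
  let B : comAlgType A := adjoin f in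
  let S : comAlgType B := split_alg (adjoin_gen f) in
  let tau : 'I_n -> S := split_root (adjoin_gen f) in
  [/\ injective (in_alg S) /\
      (forall x : S, (forall s : 'S_n, split_act s x = x) <->
                     (exists b : B, x = b%:A)),
      alg_independent (in_alg S \o in_alg B) tau
    & free_basis (fun m : {dffun forall i : 'I_n, 'I_i.+1} =>
        \prod_(i < n | (0 < i)%N) tau i ^+ m i)].
Proof.
move=> B S tau; have g_indep := adjoin_gen_indep f_indep.
have g_gen := @adjoin_gen_surj A C n f.
split.
- split; first exact: split_scalar_inj.
  exact: split_invariantsP.
- move=> p p0; apply: (mmap_root_inj g_indep g_gen).
  by rewrite p0 rmorph0.
- exact: split_stair_basis.
Qed.
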